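(* Let $Q$ be a Steiner loop, $K$ an abelian group (written additively) and $f:Q\times Q\to K$ a map satisfying $f(x,1)=0=f(1,x)$ for all $x\in Q$. Then the following conditions are equivalent: (i) $(\mathrm{id},f)$ is a C-factor set; (ii) $f(y,z)+f(y,yz)=f(x,y)+f(xy,y)$ for every $x,y,z\in Q$; (iii) for every $x,y,z\in Q$, both $f(xy,y)=f(y,y)-f(x,y)$ and $f(y,yz)=f(y,y)-f(y,z)$.
   Context: A Steiner loop is an inverse property loop of exponent two; equivalently, a commutative loop satisfying $x\cdot xy=y$. For a map $f:Q\times Q\to K$, the pair $(\mathrm{id},f)$ (where $\mathrm{id}$ denotes the trivial homomorphism $Q\to\mathrm{Aut}(K)$) is a C-factor set if $f(x,1)=0=f(1,x)$ for all $x\in Q$ and $$f(y,z)+f(y,yz)+f(x,y\cdot yz)=f(x,y)+f(xy,y)+f(xy\cdot y,z)$$ for all $x,y,z\in Q$. *)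

(* Defs.v *)
From mathcomp Require Import all_boot all_algebra.

Set Implicit Arguments.
Unset Strict Implicit.
Unset Printing Implicit Defensive.

Import GRing.Theory.
Local Open Scope ring_scope.

Section Loops.
Variable Q : baseUMagmaType.

(* The axioms of baseUMagmaType are empty: it only provides the operation and
   the distinguished element, so the unit laws are part of the definition. *)
Definition is_loop : Prop :=
  [/\ forall x : Q, (1 * x)%g = x,
      forall x : Q, (x * 1)%g = x,
      forall a b : Q, exists! x : Q, (a * x)%g = b
    & forall a b : Q, exists! y : Q, (y * a)%g = b].

Definition inverse_property : Prop :=
  forall x : Q, exists x' : Q,
    forall y : Q, (x' * (x * y))%g = y /\ ((y * x) * x')%g = y.

(* Exponent dividing two, so that the one-element loop is included. *)
Definition exponent_two : Prop := forall x : Q, (x * x)%g = 1%g.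

Definition is_Steiner_loop : Prop :=
  [/\ is_loop, inverse_property & exponent_two].

End Loops.

Section FactorSets.
Variables (Q : baseUMagmaType) (K : zmodType).

Definition normalized (f : Q -> Q -> K) : Prop :=
  forall x : Q, f x 1%g = 0 /\ f 1%g x = 0.

(* C_factor_set_id f : the pair (id, f) is a C-factor set, where id is the
   trivial homomorphism Q -> Aut(K). *)
Definition C_factor_set_id (f : Q -> Q -> K) : Prop :=
  normalized f /\
  forall x y z : Q,
    f y z + f y (y * z)%g + f x (y * (y * z))%g
      = f x y + f (x * y)%g y + f ((x * y) * y)%g z.

End FactorSets.

(* Main.v *)
Require Import Defs.
From mathcomp Require Import all_boot all_algebra.

Set Implicit Arguments.
Unset Strict Implicit.
Unset Printing Implicit Defensive.

Import GRing.Theory.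
Local Open Scope ring_scope.

(** Translations of a Steiner loop are involutions, so the last terms on the two sides of the
    C-factor identity are both [f x z]; cancelling them leaves (ii). In (ii) the left side is free
    of [x] and the right side of [z], so both depend on [y] alone, and normalization identifies the
    common value as [f y y], which is (iii). *)

Lemma Steiner_loop_mulK (Q : baseUMagmaType) (x y : Q) :
  is_Steiner_loop Q -> (x * (x * y))%g = y /\ ((y * x) * x)%g = y.
Proof.
case=> -[_ mulx1 _ _] ip xx1; have [x' x'K] := ip x.
(* Each element is its own inverse: the inverse property applied to [x] itself gives
   [x' * (x * x) = x], where [x * x = 1]. *)
suff x'E : x' = x by rewrite -{1 4}x'E; apply: x'K.
by have [] := x'K x; rewrite xx1 mulx1.
Qed.

Theorem proposition3p5 (Q : baseUMagmaType) (hQ : is_Steiner_loop Q)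
    (K : zmodType) (f : Q -> Q -> K) (hf : normalized f) :
  (C_factor_set_id f <->
     forall x y z : Q, f y z + f y (y * z)%g = f x y + f (x * y)%g y) /\
  ((forall x y z : Q, f y z + f y (y * z)%g = f x y + f (x * y)%g y) <->
     forall x y z : Q, f (x * y)%g y = f y y - f x y /\
                       f y (y * z)%g = f y y - f y z).
Proof.
have mulK (x y : Q) : (x * (x * y))%g = y by case: (Steiner_loop_mulK x y hQ).
have mulKr (x y : Q) : ((y * x) * x)%g = y by case: (Steiner_loop_mulK x y hQ).
have [[mul1x mulx1 _ _] _ _] := hQ.
split; split.
- by case=> _ fC x y z; have := fC x y z; rewrite mulK mulKr => /addIr.
- by move=> fE; split=> // x y z; rewrite mulK mulKr (fE x).
- move=> fE x y z; have [fy1 f1y] := hf y; split.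
    (* Setting [z = 1] reduces the left side of (ii) to [f y y]; setting [x = 1] does the same to
       the right side. *)
    by have := fE x y 1%g; rewrite fy1 mulx1 add0r => ->; rewrite addrC addKr.
  by have := fE 1%g y z; rewrite f1y mul1x add0r => <-; rewrite addrC addKr.
- move=> fE x y z; have [-> ->] := fE x y z.
  by rewrite !(addrC _ (f y y - _)) !subrK.
Qed.
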